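(* Let $\mathbb{F}$ be an infinite field of characteristic not $2$. Then the sequence $(\ell_{4n+2}(\mathbb{F}))_{n\geq 1}$ is non-increasing.
   Context: A symplectic form on a finite-dimensional vector space $V$ is a nondegenerate alternating bilinear form; $\mathrm{Sp}(s)$ is its isometry group in $\mathrm{GL}(V)$. An involution of a group is an element $i$ with $i^2$ equal to the identity (the identity is allowed). An element of a group is $k$-reflectional if it is the product of $k$ involutions of that group. For a positive even integer $m$, let $s$ be a symplectic form on an $m$-dimensional vector space over $\mathbb{F}$ (all such forms are isometric); $\ell_m(\mathbb{F})\in\mathbb{N}\cup\{+\infty\}$ denotes the least integer $k\geq 0$ such that every element of $\mathrm{Sp}(s)$ is $k$-reflectional in $\mathrm{Sp}(s)$, and $\ell_m(\mathbb{F})=+\infty$ if no such integer exists. *)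

(* Defs.v *)
From HB Require Import structures.
From mathcomp Require Import all_boot all_order all_algebra sesquilinear.
From mathcomp Require Import boolp classical_sets cardinality.
From mathcomp Require Import ring.

Set Implicit Arguments.
Unset Strict Implicit.
Unset Printing Implicit Defensive.

Import GRing.Theory.
Local Open Scope ring_scope.

Section SymplecticGroup.
Variables (F : fieldType) (V : vectType F) (s : {skew_symmetric V}).

Definition Sp (f : 'End(V)) : Prop := lker f = 0%VS /\ isometry s s f.

Definition Sp_involution (i : 'End(V)) : Prop := Sp i /\ (i \o i)%VF = \1%VF.

Definition reflectional (k : nat) (f : 'End(V)) : Prop :=
  exists2 t : k.-tuple 'End(V),
    forall i, i \in t -> Sp_involution i
    & f = foldr (fun i g => (i \o g)%VF) \1%VF t.

End SymplecticGroup.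

(* [is_psymplectic s] is nondegeneracy, together with [s u u = 0] in
   characteristic 2; skew-symmetry, which is part of the type of [s], implies
   [s u u = 0] in the other characteristics.
   All symplectic forms on spaces of a given dimension are isometric, so that
   the quantification over [V] and [s] amounts to fixing one of them: see
   [all_reflectionalE]. *)
Definition all_reflectional (F : fieldType) (m k : nat) : Prop :=
  forall (V : vectType F) (s : {skew_symmetric V}),
    \dim {:V} = m -> is_psymplectic s ->
    forall f : 'End(V), Sp s f -> reflectional s k f.

(* N together with +oo, the latter being represented by None. *)
Definition natoo := option nat.

Definition leoo (a b : natoo) : bool :=
  match a, b with
  | _, None => true
  | None, Some _ => false
  | Some j, Some k => (j <= k)%N
  end.

Definition leastoo (P : nat -> Prop) : natoo :=
  if pselect (exists k, `[< P k >]) is left exP then Some (ex_minn exP)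
  else None.

Definition ell (F : fieldType) (m : nat) : natoo :=
  leastoo (all_reflectional F m).

Section Uniqueness.
Variable F : fieldType.

Definition nondeg_on (V : vectType F) (s : {skew_symmetric V}) (U : {vspace V}) :=
  forall u, u \in U -> (forall v, v \in U -> s u v = 0) -> u = 0.

Lemma skewC (V : vectType F) (s : {skew_symmetric V}) u v : s u v = - s v u.
Proof. by rewrite hermC expr1 mulN1r. Qed.

Definition rank1 (V W : vectType F) (s : {skew_symmetric V}) (v : V) (w : W) :
  'Hom(V, W) := linfun (fun x => s x v *: w).

Lemma rank1E (V W : vectType F) (s : {skew_symmetric V}) (v : V) (w : W) x :
  rank1 s v w x = s x v *: w.
Proof.
have lin : linear (fun x => s x v *: w).
  by move=> a y z; rewrite linearDl linearZl_LR scalerDl scalerA.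
pose L := GRing.isLinear.Build F V W _ _ lin.
pose f : {linear V -> W} := HB.pack (fun x => s x v *: w) L.
exact: (lfunE f x).
Qed.

Lemma hyperbolic_pair (V : vectType F) (s : {skew_symmetric V}) U :
  (forall u, s u u = 0) -> nondeg_on s U -> (0 < \dim U)%N ->
  exists u v (U1 : {vspace V}),
   [/\ u \in U /\ v \in U, s u v = 1, \dim U = (\dim U1).+2,
    nondeg_on s U1 &
    [/\ (U1 <= U)%VS, forall x, x \in U1 -> s x u = 0 /\ s x v = 0 &
       forall x, x \in U -> x - s x v *: u + s x u *: v \in U1]].
Proof.
move=> alt ndg dU; have uU := memv_pick U; set u := vpick U in uU *.
have u0 : u != 0 by rewrite vpick0 -dimv_eq0 -lt0n.
have [v0 v0U suv0] : exists2 v, v \in U & s u v != 0.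
  apply: contrapT => H; case/eqP: u0; apply: ndg => // v vU.
  by apply/eqP/negPn/negP => suv; apply: H; exists v.
have [v vU suv] : exists2 v, v \in U & s u v = 1.
  by exists ((s u v0)^-1 *: v0); rewrite ?memvZ // linearZr_LR /= mulVf.
have svu : s v u = -1 by rewrite skewC suv.
pose U1 := (U :&: (orthov s <[u]> :&: orthov s <[v]>))%VS.
have U1E x : (x \in U1) = [&& x \in U, s x u == 0 & s x v == 0].
  by rewrite !memv_cap !mem_orthov1.
have U1U : (U1 <= U)%VS by apply: capvSl.
have orth x : x \in U1 -> s x u = 0 /\ s x v = 0.
  by rewrite U1E => /and3P[_ /eqP ? /eqP ?].
have proj x : x \in U -> x - s x v *: u + s x u *: v \in U1.
  move=> xU; rewrite U1E rpredD ?rpredB ?rpredZ //=.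
  rewrite !(linearDl, linearNl, linearZl_LR) /= !alt suv svu.
  by rewrite !mulr0 mulr1 mulrN1 subr0 addr0 !subrr eqxx.
exists u, v, U1; split=> //; last first.
  move=> x xU1 Hx; apply: ndg => [|y yU]; first exact: (subvP U1U).
  have := Hx _ (proj y yU); have [xu xv] := orth _ xU1.
  by rewrite !(linearDr, linearNr, linearZr_LR) /= xu xv !mulr0 subr0 addr0.
have dirUV : (<[u]> :&: <[v]> = 0)%VS.
  apply/eqP; rewrite -subv0; apply/subvP => x.
  rewrite memv_cap => /andP[/vlineP[a ->] /vlineP[b Eb]].
  have := congr1 (s^~ v) Eb; rewrite /= !linearZl_LR /= suv alt mulr0 mulr1.
  by move=> ->; rewrite scale0r mem0v.
have dirU1 : (U1 :&: (<[u]> + <[v]>) = 0)%VS.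
  apply/eqP; rewrite -subv0; apply/subvP => x; rewrite memv_cap.
  case/andP=> /orth[xu xv] /memv_addP[_ /vlineP[a ->] [_ /vlineP[b ->] Ex]].
  have := congr1 (s^~ v) Ex; have := congr1 (s^~ u) Ex.
  rewrite /= xu xv !linearDl !linearZl_LR /= !alt suv svu.
  rewrite !mulr0 mulr1 mulrN1 add0r addr0 => /esym/eqP; rewrite oppr_eq0.
  by move=> /eqP b0 /esym a0; rewrite Ex a0 b0 !scale0r addr0 mem0v.
have -> : U = (U1 + (<[u]> + <[v]>))%VS.
  apply/eqP; rewrite eqEsubv !subv_add U1U -!memvE uU vU !andbT.
  apply/subvP => x xU.
  have -> : x = x - s x v *: u + s x u *: v + (s x v *: u + - s x u *: v).
    by rewrite scaleNr addrACA subrr addr0 subrK.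
  by rewrite memv_add ?proj // memv_add ?memvZ ?memv_line.
rewrite dimv_disjoint_sum // dimv_disjoint_sum // !dim_vline u0.
have -> : v != 0 by apply: contra_eq_neq suv => ->; rewrite linear0r eq_sym oner_neq0.
by rewrite addn2.
Qed.

Lemma isometry_on n (V W : vectType F) (s : {skew_symmetric V})
    (t : {skew_symmetric W}) U U' :
  (forall u, s u u = 0) -> (forall u, t u u = 0) ->
  nondeg_on s U -> nondeg_on t U' -> (\dim U < n)%N -> \dim U = \dim U' ->
  exists phi : 'Hom(V, W), forall x, x \in U -> phi x \in U' /\
    forall y, y \in U -> t (phi x) (phi y) = s x y.
Proof.
move=> alts altt; elim: n U U' => // n IHn U U' ndU ndU' ltUn eqUU'.
have [dU0|dU] := posnP (\dim U).
  exists 0 => x; move/eqP: dU0; rewrite dimv_eq0 => /eqP->.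
  rewrite memv0 => /eqP->; rewrite linear0 mem0v; split=> // y _.
  by rewrite !linear0l.
have [u [v [U1 [[uU vU] suv eU ndU1 [U1U orth proj]]]]] := hyperbolic_pair alts ndU dU.
rewrite eqUU' in dU.
have [u' [v' [U1' [[uU' vU'] suv' eU' ndU1' [U1U' orth' _]]]]] :=
  hyperbolic_pair altt ndU' dU.
have ltU1n : (\dim U1 < n)%N by move: ltUn; rewrite eU ltnS => /ltnW.
have eqUU1 : \dim U1 = \dim U1'.
  by apply/eqP; rewrite -2!eqSS -eU -eU' eqUU'.
have [phi1 phi1P] := IHn U1 U1' ndU1 ndU1' ltU1n eqUU1.
pose p := (\1 - rank1 s v u + rank1 s u v)%VF.
have pE x : p x = x - s x v *: u + s x u *: v.
  by rewrite !lfun_simp !rank1E.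
exists (phi1 \o p + rank1 s v u' - rank1 s u v')%VF => x xU.
have p1 y : y \in U -> p y \in U1 by move=> yU; rewrite pE proj.
have phiE y : (phi1 \o p + rank1 s v u' - rank1 s u v')%VF y =
    phi1 (p y) + (s y v *: u' - s y u *: v').
  by rewrite !lfun_simp !rank1E addrA.
have [p1x H] := phi1P _ (p1 x xU).
rewrite phiE; split.
  by rewrite memvD ?memvB ?memvZ //; apply: (subvP U1U').
move=> y yU; rewrite phiE.
have [p1y _] := phi1P _ (p1 y yU).
have [xu' xv'] := orth' _ p1x; have [yu' yv'] := orth' _ p1y.
have tu'y : t u' (phi1 (p y)) = 0 by rewrite skewC yu' oppr0.
have tv'y : t v' (phi1 (p y)) = 0 by rewrite skewC yv' oppr0.
have svu : s v u = -1 by rewrite skewC suv.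
have svu' : t v' u' = -1 by rewrite skewC suv'.
rewrite !(linearDl, linearDr) !(linearNl, linearNr).
rewrite !(linearZr_LR, linearZl_LR) /= !altt suv' svu' xu' xv' tu'y tv'y.
rewrite (H _ (p1 y yU)) !pE.
rewrite !(linearDl, linearDr) !(linearNl, linearNr).
rewrite !(linearZr_LR, linearZl_LR) /= !alts suv svu (skewC s u y) (skewC s v y).
ring.
Qed.

Lemma psymplectic_alt (V : vectType F) (s : {skew_symmetric V}) :
  is_psymplectic s -> forall u, s u u = 0.
Proof.
move=> [_ _ alt2] u; have [/alt2|N2] := boolP (2 \in [pchar F]); first exact.
have : s u u *+ 2 = 0 by rewrite mulr2n {1}skewC addNr.
move/eqP; rewrite -mulr_natl mulf_eq0 => /orP[/eqP two0|/eqP//].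
by case/negP: N2; rewrite inE /= two0 eqxx.
Qed.

Lemma psymplectic_nondeg (V : vectType F) (s : {skew_symmetric V}) :
  is_psymplectic s -> nondeg_on s fullv.
Proof.
move=> [/eqP ndg _ _] u _ su0; apply/eqP; rewrite -memv0 -ndg.
by apply/mem_orthovP => v _; rewrite su0 ?memvf.
Qed.

Lemma psymplectic_isometric (V W : vectType F) (s : {skew_symmetric V})
    (t : {skew_symmetric W}) :
  is_psymplectic s -> is_psymplectic t -> \dim {:V} = \dim {:W} ->
  exists phi : 'Hom(V, W), exists psi : 'Hom(W, V),
    [/\ cancel phi psi, cancel psi phi & isometry t s phi].
Proof.
move=> hs ht eqd.
have [phi phiP] := isometry_on (psymplectic_alt hs) (psymplectic_alt ht)
  (psymplectic_nondeg hs) (psymplectic_nondeg ht) (ltnSn _) eqd.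
have iso : isometry t s phi.
  by move=> u v; have [_ ->] := phiP u (memvf u); rewrite ?memvf.
have ker0 : lker phi == 0%VS.
  rewrite -subv0; apply/subvP => u; rewrite memv_ker memv0 => /eqP phiu.
  apply/eqP/(psymplectic_nondeg hs (memvf u)) => v _.
  by rewrite -iso phiu linear0l.
have img : limg phi = fullv.
  have capk : (fullv :&: lker phi = 0)%VS by rewrite (eqP ker0) capv0.
  by apply/eqP; rewrite eqEdim subvf (limg_dim_eq capk) eqd leqnn.
exists phi, (phi^-1)%VF; split=> // [u|w]; first exact: lker0_lfunK.
by rewrite limg_lfunVK // img memvf.
Qed.

Lemma reflectional_conj (V W : vectType F) (s : {skew_symmetric V})
    (t : {skew_symmetric W}) (phi : 'Hom(V, W)) (psi : 'Hom(W, V)) k f :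
  cancel phi psi -> cancel psi phi -> isometry t s phi ->
  reflectional s k f -> reflectional t k (phi \o f \o psi)%VF.
Proof.
move=> phiK psiK iso [r rP ->].
have iso' : isometry s t psi by move=> u v; rewrite -iso !psiK.
exists (map_tuple (fun i => phi \o i \o psi)%VF r).
  move=> _ /mapP[i /rP[[_ si] ii] ->].
  have jj : ((phi \o i \o psi) \o (phi \o i \o psi) = \1)%VF.
    apply/lfunP => w; rewrite !lfun_simp /= phiK.
    by have := congr1 (fun g : 'End(V) => phi (g (psi w))) ii; rewrite !lfun_simp psiK.
  split=> //; split; last by move=> u v; rewrite !lfun_simp iso si iso'.
  apply/eqP/lker0P => u v /(congr1 (phi \o i \o psi)%VF).
  by rewrite -!comp_lfunE jj !lfun_simp.
rewrite /=; have /(_ r) -> // : forall l,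
  (phi \o foldr (fun i g => i \o g) \1 l \o psi)%VF =
  foldr (fun i g => i \o g)%VF \1%VF [seq (phi \o i \o psi)%VF | i <- l].
elim=> [|i l IHl] /=; apply/lfunP => w.
  by rewrite !comp_lfunE !id_lfunE psiK.
by rewrite -IHl !comp_lfunE phiK.
Qed.

Lemma all_reflectionalE (V : vectType F) (s : {skew_symmetric V}) k :
  is_psymplectic s ->
  all_reflectional F (\dim {:V}) k <->
  forall f : 'End(V), Sp s f -> reflectional s k f.
Proof.
move=> hs; split=> [all_k f|all_k W t eqd ht f [_ tf]]; first exact: all_k.
have [phi [psi [phiK psiK iso]]] := psymplectic_isometric ht hs eqd.
have iso' : isometry t s psi by move=> u v; rewrite -iso !psiK.
have -> : f = (psi \o (phi \o f \o psi) \o phi)%VF.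
  by apply/lfunP => w; rewrite !lfun_simp !phiK.
apply: (reflectional_conj psiK phiK iso'); apply: all_k.
have sg : isometry s s (phi \o f \o psi)%VF.
  by move=> u v; rewrite !lfun_simp iso tf iso'.
split=> //; apply/eqP; rewrite -subv0; apply/subvP => u.
rewrite memv_ker memv0 => /eqP gu.
apply/eqP/(psymplectic_nondeg hs (memvf u)) => v _.
by rewrite -sg gu linear0l.
Qed.

End Uniqueness.

(* Main.v *)
(* For any k >= 4, if every element of Sp_n is k-reflectional (n > 4), then so is
   every element of Sp_{n+4}; and k-reflectionality of all the elements forces
   k >= 4, because no transvection is a product of three involutions.

   Let g be in Sp_{n+4}. Either g acts as 1 or -1 on a nondegenerate subspace of
   dimension 4, and one is reduced to the orthogonal of that subspace, or there
   are totally isotropic dual pairs x = (x1, x2), y = (y1, y2) such that the block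
   of g at x is the identity, s (g xi) yj = delta_ij. Then g = L h R^-1 where L and
   R are unipotent in opposite parabolic subgroups and h, the Schur complement,
   fixes x and y. By hypothesis h = A B with A a product of two, and B of k - 2,
   involutions fixing x and y. Let D multiply x by d, y by d^-1, and fix their
   orthogonal. For generic d, the spectrum of the triangular map L D A splits, so
   that L D A is conjugate to D A; the latter is a product of two involutions, as
   D is a product of two involutions commuting with A. The same argument shows
   that D^-1 B R^-1 is a product of k - 2 involutions, and
   g = (L D A) (D^-1 B R^-1). *)

From HB Require Import structures.
Require Import Defs.
From mathcomp Require Import all_boot all_order all_algebra.
From mathcomp Require Import sesquilinear.
From mathcomp Require Import boolp classical_sets cardinality.
From mathcomp Require Import ring zify.

Set Implicit Arguments.
Unset Strict Implicit.
Unset Printing Implicit Defensive.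

Import GRing.Theory passmx.
Local Open Scope ring_scope.

Section Forms.
Variables (F : fieldType) (V : vectType F) (s : {skew_symmetric V}).

Lemma bilDl u v w : s (u + v) w = s u w + s v w.
Proof. exact: linearDl. Qed.

Lemma bilDr u v w : s u (v + w) = s u v + s u w.
Proof. exact: linearDr. Qed.

Lemma bilNl u v : s (- u) v = - s u v.
Proof. exact: linearNl. Qed.

Lemma bilNr u v : s u (- v) = - s u v.
Proof. exact: linearNr. Qed.

Lemma bilZl a u v : s (a *: u) v = a * s u v.
Proof. exact: linearZl_LR. Qed.

Lemma bilZr a u v : s u (a *: v) = a * s u v.
Proof. exact: linearZr_LR. Qed.

Lemma bil0l v : s 0 v = 0.
Proof. exact: linear0l. Qed.

Lemma bil0r v : s v 0 = 0.
Proof. exact: linear0r. Qed.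

Definition bilE :=
  (bilDl, bilDr, bilNl, bilNr, bilZl, bilZr, bil0l, bil0r).

Lemma pullback_skew (W : vectType F) (p q : 'Hom(W, V)) :
  (forall x y, s (p x) (q y) = - s (p y) (q x)) ->
  exists c : {skew_symmetric W}, forall x y, c x y = s (p x) (q y).
Proof.
move=> skw; pose f x y := s (p x) (q y).
have bil : bilinear_for *%R *%R f.
  by split=> z a x y; rewrite /f linearP !bilE.
pose B := bilinear_isBilinear.Build F W W F *%R *%R f bil.
have her x y : f x y = (-1) ^+ true * idfun (f y x).
  by rewrite expr1 mulN1r; apply: skw.
pose H := isHermitianSesquilinear.Build F W true idfun f her.
pose c : {skew_symmetric W} := HB.pack f B H.
by exists c.
Qed.

Lemma nondeg_on_even U :
  (forall u, s u u = 0) -> nondeg_on s U -> ~~ odd (\dim U).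
Proof.
move=> alt; have [n] := ubnP (\dim U); elim: n U => // n IHn U ltUn ndU.
have [->//|dU] := posnP (\dim U).
have [_ [_ [U1 [_ _ eU ndU1 _]]]] := hyperbolic_pair alt ndU dU.
by rewrite eU /= negbK IHn // -ltnS; move: ltUn; rewrite eU => /ltnW.
Qed.

End Forms.

Section Symplectic.
Variables (F : fieldType) (F_char : 2%N \notin [pchar F]).
Variables (V : vectType F) (s : {skew_symmetric V}) (hs : is_psymplectic s).

Lemma two_neq0 : 2 != 0 :> F.
Proof. by apply: contra F_char => /eqP two0; rewrite inE /= two0 eqxx. Qed.

Lemma double_eq0 (x : F) : x = - x -> x = 0.
Proof.
move/eqP; rewrite -subr_eq0 opprK -mulr2n -mulr_natl mulf_eq0.
by rewrite (negPf two_neq0) => /eqP.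
Qed.

Lemma salt u : s u u = 0.
Proof. exact: psymplectic_alt. Qed.

Lemma snondeg u : (forall v, s u v = 0) -> u = 0.
Proof. by move=> su; apply: (psymplectic_nondeg hs (memvf u)). Qed.

Lemma isometry_inj (f : 'End(V)) : isometry s s f -> lker f = 0%VS.
Proof.
move=> iso; apply/eqP; rewrite -subv0; apply/subvP => u.
rewrite memv_ker memv0 => /eqP fu; apply/eqP/snondeg => v.
by rewrite -iso fu bil0l.
Qed.

Lemma SpP (f : 'End(V)) : Sp s f <-> isometry s s f.
Proof. by split=> [[]//|iso]; split=> //; apply: isometry_inj. Qed.

Lemma skew_rank_even (a : 'End(V)) :
  (forall x y, s (a x) y = - s (a y) x) -> odd (\dim (lker a)) = odd (\dim {:V}).
Proof.
move=> skw; have [x y|c cE] := @pullback_skew _ _ s _ a \1%VF.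
  by rewrite !id_lfunE.
have {}cE x y : c x y = s (a x) y by rewrite cE id_lfunE.
have altc u : c u u = 0 by apply: double_eq0; rewrite {1}skewC.
have ndc : nondeg_on c (lker a)^C.
  move=> u uU cu; have /eqP au : a u == 0.
    apply/eqP/snondeg => v.
    have : v \in ((lker a)^C + lker a)%VS by rewrite addvC addv_complf memvf.
    case/memv_addP=> v1 v1U [v2]; rewrite memv_ker => /eqP av2 ->.
    by rewrite bilDr -!cE cu // (skewC c) cE av2 bil0l oppr0 addr0.
  apply/eqP; rewrite -memv0 -(capv_compl (lker a)) memv_cap uU memv_ker.
  by rewrite au eqxx.
have := nondeg_on_even altc ndc; rewrite dimv_compl => ev.
by have := oddB (dimvS (subvf (lker a))); rewrite (negPf ev); do 2!case: odd.
Qed.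

End Symplectic.

Section Reflectional.
Variables (F : fieldType) (V : vectType F) (s : {skew_symmetric V}).

Definition comps (l : seq 'End(V)) : 'End(V) :=
  foldr (fun i g => (i \o g)%VF) \1%VF l.

Lemma comps_cat l1 l2 : comps (l1 ++ l2) = (comps l1 \o comps l2)%VF.
Proof.
elim: l1 => [|i l IHl] /=; first by rewrite comp_lfun1l.
by rewrite /= -/(comps _) IHl comp_lfunA.
Qed.

Lemma reflectionalP k f :
  reflectional s k f <->
  exists l, [/\ size l = k, {in l, forall i, Sp_involution s i} & f = comps l].
Proof.
split=> [[t tP ->]|[l [/eqP szl lP ->]]]; last by exists (Tuple szl).
by exists t; rewrite size_tuple.
Qed.

Lemma Sp1 : Sp s \1%VF.
Proof.
split; last by move=> u v; rewrite !id_lfunE.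
by apply/eqP/lker0P => u v; rewrite !id_lfunE.
Qed.

Lemma Sp_comp f g : Sp s f -> Sp s g -> Sp s (f \o g)%VF.
Proof.
move=> [/eqP/lker0P kf sf] [/eqP/lker0P kg sg]; split.
  by apply/eqP/lker0P => u v; rewrite !comp_lfunE => /kf/kg.
by move=> u v; rewrite !comp_lfunE sf sg.
Qed.

Lemma involution1 : Sp_involution s \1%VF.
Proof. by split; [apply: Sp1 | rewrite comp_lfun1l]. Qed.

Lemma reflectional_comp j k f g :
  reflectional s j f -> reflectional s k g -> reflectional s (j + k) (f \o g)%VF.
Proof.
move=> /reflectionalP[l1 [s1 P1 ->]] /reflectionalP[l2 [s2 P2 ->]].
apply/reflectionalP; exists (l1 ++ l2); split; rewrite ?comps_cat //.
  by rewrite size_cat s1 s2.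
by move=> i; rewrite mem_cat => /orP[/P1|/P2].
Qed.

Lemma reflectional_leq j k f :
  (j <= k)%N -> reflectional s j f -> reflectional s k f.
Proof.
move=> /subnKC <- rf; rewrite -[f]comp_lfun1r; apply: reflectional_comp => //.
apply/reflectionalP; exists (nseq (k - j) \1%VF); split.
- by rewrite size_nseq.
- by move=> i /nseqP[-> _]; apply: involution1.
- by elim: (k - j)%N => //= n <-; rewrite comp_lfun1l.
Qed.

Lemma comps_rev l :
  {in l, forall t, Sp_involution s t} -> (comps l \o comps (rev l) = \1)%VF.
Proof.
elim: l => [|i l IHl] lP; first by rewrite comp_lfun1l.
have [_ ii] := lP i (mem_head _ _).
rewrite rev_cons -cats1 comps_cat /= -/(comps l) comp_lfun1r -comp_lfunA.
rewrite (comp_lfunA (comps l)) IHl ?comp_lfun1l // => j jl.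
by apply: lP; rewrite inE jl orbT.
Qed.

Lemma reflectional_inv k f g :
  (f \o g = \1)%VF -> reflectional s k f -> reflectional s k g.
Proof.
move=> fg /reflectionalP[l [szl lP fE]]; apply/reflectionalP.
have revP : {in rev l, forall t, Sp_involution s t}.
  by move=> i; rewrite mem_rev => /lP.
exists (rev l); rewrite size_rev; split=> //.
have := comps_rev revP; rewrite revK -fE => revf.
by rewrite -[g]comp_lfun1l -revf -comp_lfunA fg comp_lfun1r.
Qed.

Lemma involutionE i x : Sp_involution s i -> i (i x) = x.
Proof. by case=> _ ii; rewrite -comp_lfunE ii id_lfunE. Qed.

Lemma involution_adj i x y : Sp_involution s i -> s (i x) y = s x (i y).
Proof. by move=> iP; rewrite -{1}(involutionE y iP); case: iP => -[_ ->]. Qed.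

End Reflectional.

Section Transvection.
Variables (F : fieldType) (F_char : 2%N \notin [pchar F]).
Variables (V : vectType F) (s : {skew_symmetric V}) (hs : is_psymplectic s).

(* Write [f = i j k], so that [j - e i = i (f k - e)] for [e = 1, -1].  Both
   [j - e i] and [k - e] are skew for [s], hence have kernels of the same parity,
   while [f k - e] differs from [k - e] by a map of rank one whose image is
   spanned by [u]. This forces [k u = - e u] for both signs [e]. *)
Lemma transvection_not_reflectional3 (u : V) (f : 'End(V)) :
  u != 0 -> (forall x, f x = x + s x u *: u) -> ~ reflectional s 3 f.
Proof.
move=> u0 fE /reflectionalP[l [szl lP fijk]].
case: l szl lP fijk => [|i [|j [|k []]]] //= _ lP fijk.
have iP : Sp_involution s i by apply: lP; rewrite !inE eqxx.
have jP : Sp_involution s j by apply: lP; rewrite !inE eqxx orbT.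
have kP : Sp_involution s k by apply: lP; rewrite !inE eqxx !orbT.
have jE x : j x = i (f (k x)).
  by rewrite fijk !comp_lfunE id_lfunE !(involutionE _ iP) (involutionE _ kP).
suff ku e : e * e = 1 -> k u = - (e *: u).
  have := ku 1 (mulr1 1); rewrite (ku (-1)) ?mulrNN ?mulr1 // scaleN1r opprK.
  rewrite scale1r => /eqP; rewrite -subr_eq0 opprK -mulr2n -scaler_nat.
  by rewrite scaler_eq0 (negPf u0) (negPf (two_neq0 F_char)).
move=> ee; apply/eqP; apply: contraT => nku.
pose p := k u + e *: u; have p0 : p != 0 by rewrite addr_eq0.
pose a := (k - e *: \1)%VF; pose b := (j - e *: i)%VF.
have aE x : a x = k x - e *: x by rewrite !lfun_simp.
have bE x : b x = j x - e *: i x by rewrite !lfun_simp.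
have ska x y : s (a x) y = - s (a y) x.
  rewrite !aE !bilE (involution_adj _ _ kP) (skewC s x (k y)) (skewC s x y).
  ring.
have skb x y : s (b x) y = - s (b y) x.
  rewrite !bE !bilE !(involution_adj _ _ iP, involution_adj _ _ jP).
  rewrite (skewC s y (j x)) (skewC s y (i x)).
  by rewrite !(involution_adj _ _ iP, involution_adj _ _ jP); ring.
have kerb : lker b = (lker a :&: orthov s <[u]>)%VS.
  apply/vspaceP => x; rewrite memv_cap mem_orthov1 !memv_ker aE bE jE fE.
  have -> : i (k x + s (k x) u *: u) - e *: i x =
            i (k x - e *: x + s (k x) u *: u).
    by rewrite !linearD linearN !linearZ /= addrAC.
  apply/eqP/andP => [/(congr1 i)|[/eqP/subr0_eq-> /eqP xu]].
    rewrite linear0 (involutionE _ iP) => ifx.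
    have /eqP : s (k x) u *: p = 0.
      have : k (k x - e *: x + s (k x) u *: u) + e *: (k x - e *: x + s (k x) u *: u) = 0.
        by rewrite ifx linear0 scaler0 addr0.
      rewrite !linearD linearN /= !linearZ /= (involutionE _ kP) => <-.
      rewrite scalerN !scalerA ee scale1r [e * s _ _]mulrC.
      by rewrite -[e *: k x - x]opprB addrACA subrr add0r.
    rewrite scaler_eq0 (negPf p0) orbF => /eqP kxu.
    move: ifx; rewrite kxu scale0r addr0 => kx; split; first exact/eqP.
    move: kxu; rewrite (subr0_eq kx) bilE => /(congr1 ( *%R e)).
    by rewrite mulrA ee mul1r mulr0 => ->.
  by rewrite subrr add0r bilE xu mulr0 scale0r linear0.
have [x xa xu] : exists2 x, x \in lker a & s u x != 0.
  have [z zp] : exists z, s z p != 0.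
    apply: contrapT => H; case/eqP: p0; apply: (snondeg hs) => v.
    rewrite skewC; apply/eqP; rewrite oppr_eq0; apply/negPn/negP => ?.
    by apply: H; exists v.
  exists (k z + e *: z).
    have kz : k (k z + e *: z) = z + e *: k z.
      by rewrite linearD linearZ /= (involutionE _ kP).
    by rewrite memv_ker aE kz scalerDr scalerA ee scale1r [z + _]addrC subrr.
  apply: contra_neq zp => uz; rewrite -oppr0 -uz skewC /p !bilE.
  by rewrite (skewC s (k u)) (skewC s u z) -(involution_adj _ _ kP) skewC; ring.
have du : (\dim (lker a)).-1 = \dim (lker b).
  by rewrite kerb; apply: eq_dim_orthov1; apply/mem_orthovPn; exists x.
have da : (0 < \dim (lker a))%N.
  rewrite lt0n dimv_eq0; apply: contraNneq xu => k0; move: xa.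
  by rewrite k0 memv0 => /eqP->; rewrite bil0r.
have : odd (\dim (lker a)) = odd (\dim (lker b)).
  by rewrite !(skew_rank_even F_char hs).
by rewrite -du -[in LHS](prednK da) /=; case: odd.
Qed.

End Transvection.

Section Frames.
Variable F : fieldType.
Variables (V : vectType F) (s : {skew_symmetric V}) (hs : is_psymplectic s).

Definition frame (x1 x2 y1 y2 : V) : Prop :=
  [/\ s x1 x2 = 0, s y1 y2 = 0 &
      [/\ s x1 y1 = 1, s x1 y2 = 0, s x2 y1 = 0 & s x2 y2 = 1]].

Definition off (x1 x2 y1 y2 v : V) : Prop :=
  [/\ s v x1 = 0, s v x2 = 0, s v y1 = 0 & s v y2 = 0].

Definition fixes (x1 x2 y1 y2 : V) (f : 'End(V)) : Prop :=
  [/\ f x1 = x1, f x2 = x2, f y1 = y1 & f y2 = y2].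

Lemma offE x1 x2 y1 y2 v : off x1 x2 y1 y2 v ->
  (s v x1 = 0) * (s v x2 = 0) * (s v y1 = 0) * (s v y2 = 0) *
  (s x1 v = 0) * (s x2 v = 0) * (s y1 v = 0) * (s y2 v = 0).
Proof. by case=> v1 v2 v3 v4; do !split=> //; rewrite skewC ?v1 ?v2 ?v3 ?v4 oppr0. Qed.

Lemma frameE x1 x2 y1 y2 : frame x1 x2 y1 y2 ->
  (s x1 x1 = 0) * (s x1 x2 = 0) * (s x1 y1 = 1) * (s x1 y2 = 0) *
  (s x2 x1 = 0) * (s x2 x2 = 0) * (s x2 y1 = 0) * (s x2 y2 = 1) *
  ((s y1 x1 = -1) * (s y1 x2 = 0) * (s y1 y1 = 0) * (s y1 y2 = 0)) *
  ((s y2 x1 = 0) * (s y2 x2 = -1) * (s y2 y1 = 0) * (s y2 y2 = 0)).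
Proof.
case=> e1 e2 [e3 e4 e5 e6]; do !split=> //; rewrite ?(salt hs) //.
all: by rewrite skewC ?(e1, e2, e3, e4, e5, e6) ?oppr0.
Qed.

Lemma frame_swap x1 x2 y1 y2 :
  frame x1 x2 y1 y2 -> frame y1 y2 (- x1) (- x2).
Proof.
move=> fr; split; first by rewrite (frameE fr).
  by rewrite !bilE (frameE fr) !oppr0.
by split; rewrite bilE (frameE fr) ?opprK ?oppr0.
Qed.

Lemma off_swap x1 x2 y1 y2 v :
  off y1 y2 (- x1) (- x2) v <-> off x1 x2 y1 y2 v.
Proof.
split=> -[e1 e2 e3 e4]; last by split; rewrite ?bilNr ?e1 ?e2 ?oppr0.
by split=> //; apply/eqP; rewrite -oppr_eq0 -bilNr ?e3 ?e4.
Qed.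

End Frames.

Section FrameMaps.
Variable F : fieldType.
Variables (V : vectType F) (s : {skew_symmetric V}) (hs : is_psymplectic s).
Variables (x1 x2 y1 y2 : V) (fr : frame s x1 x2 y1 y2).

Let fE := frameE hs fr.

Definition fproj : 'End(V) :=
  (\1 - rank1 s y1 x1 - rank1 s y2 x2 + rank1 s x1 y1 + rank1 s x2 y2)%VF.

Lemma fprojE v :
  fproj v = v - s v y1 *: x1 - s v y2 *: x2 + s v x1 *: y1 + s v x2 *: y2.
Proof. by rewrite !lfun_simp !rank1E. Qed.

Lemma fproj_off v : off s x1 x2 y1 y2 (fproj v).
Proof. by rewrite fprojE; split; rewrite !bilE !fE; ring. Qed.

Lemma fproj_id w : off s x1 x2 y1 y2 w -> fproj w = w.
Proof. by move=> /offE w0; rewrite fprojE !w0 !scale0r !(subr0, addr0). Qed.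

Lemma fproj_frame : [/\ fproj x1 = 0, fproj x2 = 0, fproj y1 = 0 & fproj y2 = 0].
Proof.
split; rewrite fprojE !fE !scale0r ?scaleN1r ?scale1r.
all: by rewrite !(subr0, addr0) subrr.
Qed.

Lemma frame_dec v :
  v = s v y1 *: x1 + s v y2 *: x2 - s v x1 *: y1 - s v x2 *: y2 + fproj v.
Proof.
set a := (_ - _ in RHS); have -> : fproj v = v - a.
  by rewrite fprojE /a !opprD !opprK !addrA.
by rewrite addrC subrK.
Qed.

Lemma frame_ext (f g : 'End(V)) :
  [/\ f x1 = g x1, f x2 = g x2, f y1 = g y1 & f y2 = g y2] ->
  (forall w, off s x1 x2 y1 y2 w -> f w = g w) -> f = g.
Proof.
move=> [e1 e2 e3 e4] e5; apply/lfunP => v; rewrite (frame_dec v).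
by rewrite !(linearD, linearN, linearZ) /= e1 e2 e3 e4 e5 //; apply: fproj_off.
Qed.

Definition fmap (a1 a2 b1 b2 : V) (h : 'End(V)) : 'End(V) :=
  (rank1 s y1 a1 + rank1 s y2 a2 - rank1 s x1 b1 - rank1 s x2 b2
    + (h \o fproj))%VF.

Section FmapTheory.
Variables (a1 a2 b1 b2 : V) (h : 'End(V)).
Local Notation f := (fmap a1 a2 b1 b2 h).

Lemma fmapE v :
  f v = s v y1 *: a1 + s v y2 *: a2 - s v x1 *: b1 - s v x2 *: b2 + h (fproj v).
Proof. by rewrite !lfun_simp !rank1E. Qed.

Lemma fmap_off w : off s x1 x2 y1 y2 w -> f w = h w.
Proof.
move=> ow; rewrite fmapE fproj_id // !(offE ow) !scale0r.
by rewrite !(subr0, addr0) add0r.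
Qed.

Lemma fmap_x1 : f x1 = a1.
Proof.
rewrite fmapE fprojE !fE !scale0r !scale1r !(subr0, addr0) subrr.
by rewrite linear0 addr0.
Qed.

Lemma fmap_x2 : f x2 = a2.
Proof.
rewrite fmapE fprojE !fE !scale0r !scale1r !(subr0, addr0) add0r subrr.
by rewrite linear0 addr0.
Qed.

Lemma fmap_y1 : f y1 = b1.
Proof.
rewrite fmapE fprojE !fE !scale0r !scaleN1r !(subr0, addr0, add0r, opprK).
by rewrite subrr linear0 addr0.
Qed.

Lemma fmap_y2 : f y2 = b2.
Proof.
rewrite fmapE fprojE !fE !scale0r !scaleN1r !(subr0, addr0, add0r, opprK).
by rewrite subrr linear0 addr0.
Qed.

Lemma fmap_isometry :
  frame s a1 a2 b1 b2 ->
  (forall w, off s x1 x2 y1 y2 w -> off s a1 a2 b1 b2 (h w)) ->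
  (forall w w', off s x1 x2 y1 y2 w -> off s x1 x2 y1 y2 w' ->
     s (h w) (h w') = s w w') ->
  isometry s s f.
Proof.
move=> fr' hoff hiso u v; rewrite !fmapE !bilE !(frameE hs fr').
rewrite !(offE (hoff _ (fproj_off u))) !(offE (hoff _ (fproj_off v))).
rewrite hiso; [|exact: fproj_off|exact: fproj_off].
rewrite [in RHS](frame_dec u) [in RHS](frame_dec v) !bilE !fE.
by rewrite !(offE (fproj_off u)) !(offE (fproj_off v)); ring.
Qed.

End FmapTheory.

Lemma fixes_off (t : 'End(V)) w :
  isometry s s t -> fixes x1 x2 y1 y2 t ->
  off s x1 x2 y1 y2 w -> off s x1 x2 y1 y2 (t w).
Proof.
move=> it [e1 e2 e3 e4] [o1 o2 o3 o4].
by split; [rewrite -e1 it|rewrite -e2 it|rewrite -e3 it|rewrite -e4 it].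
Qed.

Definition fmapW a1 a2 b1 b2 := (fmap_x1 a1 a2 b1 b2, fmap_x2 a1 a2 b1 b2,
  fmap_y1 a1 a2 b1 b2, fmap_y2 a1 a2 b1 b2).

Lemma fmap_comm (t : 'End(V)) a1 a2 b1 b2 :
  isometry s s t -> fixes x1 x2 y1 y2 t -> fixes a1 a2 b1 b2 t ->
  (t \o fmap a1 a2 b1 b2 \1 = fmap a1 a2 b1 b2 \1 \o t)%VF.
Proof.
move=> it ft [e1 e2 e3 e4]; have [f1 f2 f3 f4] := ft.
apply: frame_ext => [|w ow]; rewrite !comp_lfunE.
  by rewrite f1 f2 f3 f4 !fmapW.
by rewrite !fmap_off ?id_lfunE //; apply: fixes_off.
Qed.

Definition dil (d : F) := fmap (d *: x1) (d *: x2) (d^-1 *: y1) (d^-1 *: y2) \1.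

Definition swp (d : F) :=
  fmap (d *: y2) (- d *: y1) (- d^-1 *: x2) (d^-1 *: x1) \1.

Lemma dilE d : [/\ dil d x1 = d *: x1, dil d x2 = d *: x2,
  dil d y1 = d^-1 *: y1 & dil d y2 = d^-1 *: y2].
Proof. by rewrite /dil !fmapW. Qed.

Lemma dil_off d w : off s x1 x2 y1 y2 w -> dil d w = w.
Proof. by move=> ow; rewrite /dil fmap_off ?id_lfunE. Qed.

Lemma dil_isometry d : d != 0 -> isometry s s (dil d).
Proof.
move=> d0; apply: fmap_isometry => [|w [o1 o2 o3 o4]|w w' _ _].
- split; [by rewrite !bilE fE !mulr0|by rewrite !bilE fE !mulr0|].
  by split; rewrite !bilE ?fE ?mulr0 ?mulr1 ?divff.
- by rewrite id_lfunE; split; rewrite bilE ?(o1, o2, o3, o4) mulr0.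
- by rewrite !id_lfunE.
Qed.

Lemma swp_isometry d : d != 0 -> isometry s s (swp d).
Proof.
move=> d0; apply: fmap_isometry => [|w [o1 o2 o3 o4]|w w' _ _].
- split; [by rewrite !bilE fE !mulr0|by rewrite !bilE fE !mulr0|].
  by split; rewrite !bilE ?fE ?mulr0 ?mulrN1 ?mulrN ?mulNr ?mulr1 ?opprK ?divff.
- by rewrite id_lfunE; split; rewrite bilE ?(o1, o2, o3, o4) mulr0.
- by rewrite !id_lfunE.
Qed.

Lemma swp_swp c d : c != 0 -> (swp c \o swp d)%VF = dil (c^-1 * d).
Proof.
move=> c0; apply: frame_ext => [|w ow]; rewrite !comp_lfunE /swp /dil; last first.
  by rewrite !fmap_off ?id_lfunE.
rewrite !fmapW !linearZ /= !fmapW !scalerA !(mulrN, mulNr, opprK) invfM invrK.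
by split; congr (_ *: _); rewrite mulrC.
Qed.

Lemma dil1 : dil 1 = \1%VF.
Proof.
apply: frame_ext => [|w ow]; last by rewrite /dil fmap_off.
by rewrite /dil !fmapW !id_lfunE invr1 !scale1r.
Qed.

Lemma swp_comp_involution d t :
  d != 0 -> Sp_involution s t -> fixes x1 x2 y1 y2 t ->
  Sp_involution s (swp d \o t)%VF.
Proof.
move=> d0 [[kt it] tt] ft; have [e1 e2 e3 e4] := ft.
have ct : (t \o swp d = swp d \o t)%VF.
  by apply: fmap_comm => //; split; rewrite linearZ /= ?(e1, e2, e3, e4).
split; last first.
  rewrite -comp_lfunA [(t \o (_ \o _))%VF]comp_lfunA ct -comp_lfunA tt comp_lfun1r.
  by rewrite swp_swp // mulVf // dil1.
by apply: Sp_comp; [apply/(SpP hs)/swp_isometry|split].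
Qed.

Lemma dil_comp_reflectional d l :
  d != 0 -> (1 < size l)%N -> {in l, forall t, Sp_involution s t} ->
  {in l, forall t, fixes x1 x2 y1 y2 t} ->
  reflectional s (size l) (dil d \o comps l)%VF.
Proof.
move=> d0; case: l => [|t1 [|t2 l]] // _ lP lfix.
have t2P : Sp_involution s t2 by apply: lP; rewrite !inE eqxx orbT.
have t1P : Sp_involution s t1 by apply: lP; rewrite !inE eqxx.
have t2f : fixes x1 x2 y1 y2 t2 by apply: lfix; rewrite !inE eqxx orbT.
have t1f : fixes x1 x2 y1 y2 t1 by apply: lfix; rewrite !inE eqxx.
apply/reflectionalP; exists [:: swp 1 \o t1, swp d \o t2 & l]%VF; split; first by [].
  move=> i; rewrite !inE => /or3P[/eqP->|/eqP->|il].
  - by apply: swp_comp_involution; rewrite ?oner_neq0.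
  - exact: swp_comp_involution.
  - by apply: lP; rewrite !inE il !orbT.
have -> : dil d = (swp 1 \o swp d)%VF by rewrite swp_swp ?oner_neq0 // invr1 mul1r.
rewrite /= -/(comps l).
rewrite -!comp_lfunA; congr (_ \o _)%VF; rewrite !comp_lfunA; congr (_ \o _)%VF.
congr (_ \o _)%VF; case: t1P t1f => [[_ it1] _] t1f; have [e1 e2 e3 e4] := t1f.
by rewrite /swp fmap_comm //; split; rewrite linearZ /= ?(e1, e2, e3, e4).
Qed.

End FrameMaps.

Lemma dil_swap (F : fieldType) (V : vectType F) (s : {skew_symmetric V})
    (hs : is_psymplectic s) x1 x2 y1 y2 d :
  frame s x1 x2 y1 y2 ->
  dil s y1 y2 (- x1) (- x2) d^-1 = dil s x1 x2 y1 y2 d.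
Proof.
move=> fr; have fr' := frame_swap hs fr.
have [a1 a2 a3 a4] := dilE hs fr d.
have [b1 b2 b3 b4] := dilE hs fr' d^-1; rewrite invrK in b3 b4.
apply: (frame_ext hs fr) => [|w ow]; last first.
  by rewrite !dil_off //; apply/off_swap.
rewrite a1 a2 a3 a4 b1 b2; split=> //.
  by apply: oppr_inj; rewrite -scalerN -b3 linearN.
by apply: oppr_inj; rewrite -scalerN -b4 linearN.
Qed.

Section Conjugation.
Variable F : fieldType.
Variables (V : vectType F) (s : {skew_symmetric V}) (hs : is_psymplectic s).
Variables (x1 x2 y1 y2 : V) (fr : frame s x1 x2 y1 y2).

(* The terms along [y1] and [y2] are those that make the image of the orthogonal
   of the frame orthogonal to [z1] and [z2]. *)
Definition lft z1 z2 : 'End(V) :=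
  fmap s x1 x2 y1 y2 z1 z2 y1 y2 (\1 + rank1 s z1 y1 + rank1 s z2 y2)%VF.

Section LftTheory.
Variables (z1 z2 : V) (fz : frame s z1 z2 y1 y2).

Lemma lft_x1 : lft z1 z2 x1 = z1. Proof. exact: fmap_x1. Qed.
Lemma lft_x2 : lft z1 z2 x2 = z2. Proof. exact: fmap_x2. Qed.
Lemma lft_y1 : lft z1 z2 y1 = y1. Proof. exact: fmap_y1. Qed.
Lemma lft_y2 : lft z1 z2 y2 = y2. Proof. exact: fmap_y2. Qed.

Lemma lft_off w :
  off s x1 x2 y1 y2 w -> lft z1 z2 w = w + s w z1 *: y1 + s w z2 *: y2.
Proof. by move=> ow; rewrite /lft fmap_off // !lfun_simp !rank1E. Qed.

Lemma lft_isometry : isometry s s (lft z1 z2).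
Proof.
have zE := frameE hs fz.
have hE w : (\1 + rank1 s z1 y1 + rank1 s z2 y2)%VF w
    = w + s w z1 *: y1 + s w z2 *: y2 by rewrite !lfun_simp !rank1E.
apply: fmap_isometry => // [w ow|w w' ow ow']; rewrite !hE.
  by split; rewrite !bilE !zE ?(offE ow); ring.
rewrite !bilE !zE (offE ow) (offE ow) !(offE ow'); ring.
Qed.

End LftTheory.

(* In the block decomposition along [<y1, y2> <= <y1, y2>^orth], the map
   [lft z1 z2 \o dil d \o A] is triangular with diagonal blocks [d^-1], [A], [d];
   as [d] is not an eigenvalue of the first two, the eigenvectors for [d] span a
   complement [<x1', x2'>], and [lft x1' x2'] is the conjugating map. *)
Lemma lft_dil_conj z1 z2 d (A : 'End(V)) :
  frame s z1 z2 y1 y2 -> isometry s s A -> fixes x1 x2 y1 y2 A ->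
  d != 0 -> d * d != 1 -> (forall w, A w = d *: w -> w = 0) ->
  exists Q Q' : 'End(V), [/\ cancel Q Q', cancel Q' Q, isometry s s Q &
    (lft z1 z2 \o (dil s x1 x2 y1 y2 d \o A) =
       Q \o (dil s x1 x2 y1 y2 d \o A) \o Q')%VF].
Proof.
move=> fz iA fA d0 d1 eigA.
set D := dil s x1 x2 y1 y2 d; pose M := (lft z1 z2 \o (D \o A))%VF.
have [A1 A2 A3 A4] := fA; have fE := frameE hs fr.
have ME x : M x = lft z1 z2 (D (A x)) by rewrite !comp_lfunE.
have iD : isometry s s D by apply: dil_isometry.
have iM : isometry s s M by move=> u v; rewrite !ME lft_isometry // iD iA.
have Dw w : off s x1 x2 y1 y2 w -> D w = w by apply: dil_off.
have Aoff w := fixes_off iA fA (w := w).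
have [DxE1 DxE2 DyE1 DyE2] := dilE hs fr d; rewrite -/D in DxE1 DxE2 DyE1 DyE2.
have My1 : M y1 = d^-1 *: y1 by rewrite ME A3 DyE1 linearZ /= lft_y1.
have My2 : M y2 = d^-1 *: y2 by rewrite ME A4 DyE2 linearZ /= lft_y2.
have Mw w : off s x1 x2 y1 y2 w ->
    M w = A w + s (A w) z1 *: y1 + s (A w) z2 *: y2.
  by move=> ow; rewrite ME Dw ?lft_off //; apply: Aoff.
have adj1 v : s (M v) y1 = d * s v y1.
  by rewrite -(iM v) My1 bilE mulrA divff // mul1r.
have adj2 v : s (M v) y2 = d * s v y2.
  by rewrite -(iM v) My2 bilE mulrA divff // mul1r.
pose U := (orthov s <[y1]> :&: orthov s <[y2]>)%VS.
have UP v : (v \in U) = (s v y1 == 0) && (s v y2 == 0).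
  by rewrite memv_cap !mem_orthov1.
pose N := (M - d *: \1)%VF.
have NE v : N v = M v - d *: v by rewrite !lfun_simp.
have NU v : N v \in U.
  by rewrite UP NE !bilE adj1 adj2 !subrr eqxx.
have kerN : (U :&: lker N = 0)%VS.
  apply/eqP; rewrite -subv0; apply/subvP => v.
  rewrite memv_cap UP memv_ker NE memv0 subr_eq0.
  case/andP=> /andP[/eqP v1 /eqP v2] /eqP Mv.
  pose w := fproj s x1 x2 y1 y2 v.
  have ow : off s x1 x2 y1 y2 w by apply: fproj_off.
  have [a [b vE]] : exists a b, v = a *: y1 + b *: y2 + w.
    exists (- s v x1), (- s v x2).
    by rewrite {1}(frame_dec s x1 x2 y1 y2 v) v1 v2 !scale0r addr0 add0r !scaleNr.
  have MvE : M v = d^-1 *: (a *: y1 + b *: y2) + M w.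
    rewrite {1}vE 2!linearD !linearZ /= My1 My2 scalerDr !scalerA.
    by rewrite ![_ * d^-1]mulrC.
  have w0 : w = 0.
    apply: eigA; have := congr1 (fproj s x1 x2 y1 y2) Mv.
    rewrite linearZ /= -/w => <-.
    have [_ _ P3 P4] := fproj_frame hs fr.
    rewrite MvE (Mw w ow) !linearD !linearZ /= P3 P4.
    by rewrite (fproj_id (Aoff w ow)) !scaler0 !addr0 add0r.
  have dd : d^-1 - d != 0.
    apply: contra d1; rewrite subr_eq0 => /eqP dV.
    by rewrite -{1}dV mulVf.
  have : (d^-1 - d) *: v = 0.
    by rewrite scalerBl -Mv MvE {1}vE w0 linear0 !addr0 subrr.
  by move/eqP; rewrite scaler_eq0 (negPf dd).
have imN : (N @: U)%VS = U.
  apply/eqP; rewrite eqEdim (limg_dim_eq kerN) leqnn andbT.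
  by apply/subvP => _ /memv_imgP[v _ ->].
have ex x : exists2 u, u \in U & M (x - u) = d *: (x - u).
  have : N x \in (N @: U)%VS by rewrite imN.
  case/memv_imgP=> u uU Nxu; exists u => //.
  by apply/eqP; rewrite -subr_eq0 -NE linearB /= Nxu subrr.
have [u1 u1U Mu1] := ex x1; have [u2 u2U Mu2] := ex x2.
move: u1U u2U; rewrite !UP => /andP[/eqP u11 /eqP u12] /andP[/eqP u21 /eqP u22].
set x1' := x1 - u1 in Mu1; set x2' := x2 - u2 in Mu2.
have fx' : frame s x1' x2' y1 y2.
  split; [|by rewrite fE|by split; rewrite !bilE fE ?(u11, u12, u21, u22) subr0].
  apply/eqP; move/eqP: (iM x1' x2'); rewrite Mu1 Mu2 bilZl bilZr mulrA -subr_eq0.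
  rewrite -[X in _ - X]mul1r -mulrBl mulf_eq0 subr_eq0 (negPf d1).
  by [].
clearbody x1' x2'; pose Q := lft x1' x2'; have iQ : isometry s s Q by apply: lft_isometry.
have kQ : lker Q == 0%VS by rewrite (isometry_inj hs iQ).
exists Q, (Q^-1)%VF; split=> //; first exact: lker0_lfunK.
  exact: lker0_lfunVK.
suff MQ : (M \o Q = Q \o (D \o A))%VF.
  by rewrite -MQ -comp_lfunA lker0_compfV // comp_lfun1r.
have Qx1 : Q x1 = x1' by apply: lft_x1.
have Qx2 : Q x2 = x2' by apply: lft_x2.
have Qy1 : Q y1 = y1 by apply: lft_y1.
have Qy2 : Q y2 = y2 by apply: lft_y2.
clearbody M; apply: (frame_ext hs fr) => [|w ow].
  rewrite !comp_lfunE Qx1 Qx2 Qy1 Qy2 A1 A2 A3 A4 DxE1 DxE2 DyE1 DyE2.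
  by rewrite !linearZ /= Qx1 Qx2 Qy1 Qy2 Mu1 Mu2 My1 My2.
have oAw := Aoff w ow; rewrite !comp_lfunE Dw //.
have [e1 [e2 eE]] : exists e1 e2, M (Q w) = Q (A w) + e1 *: y1 + e2 *: y2.
  pose Y := (<[y1]> + <[y2]>)%VS.
  have YP a b : a *: y1 + b *: y2 \in Y by rewrite memv_add ?memvZ ?memv_line.
  have addlK (u p q : V) : u + p + q - u = p + q.
    by rewrite addrAC [u + p]addrC addrK.
  have MQ : M (Q w - w) \in Y.
    rewrite (lft_off x1' x2' ow) addlK linearD !linearZ /=.
    by rewrite My1 My2 !scalerA YP.
  have MA : M w - A w \in Y by rewrite Mw // addlK YP.
  have QA : Q (A w) - A w \in Y.
    by rewrite (lft_off x1' x2' oAw) addlK YP.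
  have /memv_addP[_ /vlineP[e1 ->] [_ /vlineP[e2 ->] eE]] :
    M (Q w) - Q (A w) \in Y.
    have -> : M (Q w) - Q (A w) = M (Q w - w) + (M w - A w) - (Q (A w) - A w).
      by rewrite linearB /= addrA subrK opprB addrA subrK.
    by apply: memvB => //; apply: memvD.
  by exists e1, e2; rewrite -addrA -eE addrC subrK.
have orth1 v : s (M (Q v)) x1' = d^-1 * s v x1.
  by rewrite -(iQ v) Qx1 -(iM (Q v)) Mu1 bilZr mulKf.
have orth2 v : s (M (Q v)) x2' = d^-1 * s v x2.
  by rewrite -(iQ v) Qx2 -(iM (Q v)) Mu2 bilZr mulKf.
have xE := frameE hs fx'.
have := orth1 w; rewrite eE !bilE !xE -{1}Qx1 iQ !(offE oAw) (offE ow).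
have := orth2 w; rewrite eE !bilE !xE -{1}Qx2 iQ !(offE oAw) (offE ow).
rewrite !mulr0 !mulrN1 !add0r addr0.
by move=> /eqP/[!oppr_eq0]/eqP-> /eqP/[!oppr_eq0]/eqP->; rewrite !scale0r !addr0.
Qed.

End Conjugation.

Section GenericScalar.
Variables (F : fieldType) (F_infinite : infinite_set [set: F]%classic).

Lemma infinite_nonroot (p : {poly F}) : p != 0 -> exists d, ~~ root p d.
Proof.
move=> p0; apply: contrapT => Hroot.
have allroot d : root p d by apply/negPn/negP => ?; apply: Hroot; exists d.
suff [r [ru szr]] : exists r : seq F, uniq r /\ size r = size p.
  have ar : all (root p) r by apply/allP => x _; apply: allroot.
  by have := max_poly_roots p0 ar ru; rewrite szr ltnn.
elim: (size p) => [|n [r [ru szr]]]; first by exists [::].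
have [x xr] : exists x, x \notin r.
  apply: contrapT => Hx; apply: F_infinite; apply/finite_seqP; exists r.
  apply/seteqP; split=> // x _ /=; apply: contrapT => /negP xr.
  by apply: Hx; exists x.
by exists (x :: r); rewrite /= xr ru szr.
Qed.

Lemma generic_scalar (V : vectType F) (A B : 'End(V)) :
  exists d, [/\ d != 0, d * d != 1, forall w, A w = d *: w -> w = 0 &
                forall w, B w = d *: w -> w = 0].
Proof.
have eb := vbasisP (@fullv F V); set e := vbasis _ in eb.
pose p (f : 'End(V)) := char_poly (mxof e e f).
have pP f d w : ~~ root (p f) d -> f w = d *: w -> w = 0.
  rewrite -eigenvalue_root_char => nd fw; apply/eqP; apply: contraR nd => w0.
  apply/eigenvalueP; exists (rVof e w); last by rewrite rVof_eq0.
  by rewrite -rVof_app // fw linearZ.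
have p0 f : p f != 0 by apply/monic_neq0/char_poly_monic.
have [d] : exists d, ~~ root ('X * ('X^2 - 1) * p A * p B) d.
  apply: infinite_nonroot; rewrite !mulf_neq0 ?p0 ?polyX_eq0 //.
  by rewrite -size_poly_eq0 size_XnsubC.
rewrite !rootM !negb_or => /andP[/andP[/andP[d0 d1] dA] dB].
exists d; split; [by rewrite rootX in d0| |move=> w; exact: pP|move=> w; exact: pP].
by move: d1; rewrite /root !hornerE subr_eq0.
Qed.

End GenericScalar.

Section Orthogonal.
Variables (F : fieldType) (V : vectType F) (s : {skew_symmetric V}).
Variable hs : is_psymplectic s.
Implicit Types U K P H : {vspace V}.

Lemma dim_orthov_ge U : (\dim {:V} <= \dim U + \dim (orthov s U))%N.
Proof.
rewrite -{2}(span_basis (vbasisP U)) -{1}(size_tuple (vbasis U)).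
elim: (tval (vbasis U)) => [|x X IHX] /=; first by rewrite span_nil orthov0.
apply: (leq_trans IHX).
have -> : orthov s <<x :: X>> = (orthov s <<X>> :&: orthov s <[x]>)%VS.
  apply/vspaceP => y; rewrite memv_cap !mem_orthov_sym span_cons subv_add.
  by rewrite andbC.
by rewrite addSn -addnS leq_add2l (leq_trans (leqSpred _)) // ltnS leq_dim_orthov1.
Qed.

Lemma dim_orthov U : (\dim U + \dim (orthov s U) = \dim {:V})%N.
Proof.
apply/eqP; rewrite eqn_leq dim_orthov_ge andbT.
set C := ((orthov s U)^C)%VS.
have UC : (U :&: orthov s C = 0)%VS.
  apply/eqP; rewrite -subv0; apply/subvP => u; rewrite memv_cap memv0.
  case/andP=> uU /mem_orthovP uC; apply/eqP/(snondeg hs) => v.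
  have : v \in (orthov s U + C)%VS by rewrite addv_complf memvf.
  case/memv_addP=> a /mem_orthovP aU [b bC ->].
  by rewrite bilDr (uC b bC) addr0 skewC aU ?oppr0.
have := dimvS (subvf (U + orthov s C)); rewrite dimv_disjoint_sum //.
have := dim_orthov_ge C; have := dimvS (subvf (orthov s U)).
by rewrite dimv_compl; lia.
Qed.

Lemma orthovK U : orthov s (orthov s U) = U.
Proof.
apply/esym/eqP; rewrite eqEdim; apply/andP; split.
  by rewrite orthov_sym subvv.
by have := dim_orthov U; have := dim_orthov (orthov s U); lia.
Qed.

Lemma dual_vector e U : e \notin U ->
  exists2 y, forall v, v \in U -> s v y = 0 & s e y = 1.
Proof.
rewrite -{1}(orthovK U) => /mem_orthovPn[y /mem_orthovP yU ey].
exists ((s e y)^-1 *: y); last by rewrite bilZr mulVf.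
by move=> v vU; rewrite bilZr (skewC s v y) yU ?oppr0 ?mulr0.
Qed.

Lemma hyperbolic_in K : (\dim {:V} < (\dim K).*2)%N ->
  exists u v, [/\ u \in K, v \in K & s u v = 1].
Proof.
move=> dK; apply: contrapT => Huv.
have : (K <= orthov s K)%VS.
  apply/orthovP => u v uK vK; apply: contrapT => /eqP uv; apply: Huv.
  by exists u, ((s u v)^-1 *: v); rewrite uK memvZ // bilZr mulVf.
by move/dimvS; have := dim_orthov K; lia.
Qed.

Lemma frame_in K : (\dim {:V} + 2 < (\dim K).*2)%N ->
  exists x1 x2 y1 y2, frame s x1 x2 y1 y2 /\
    [/\ x1 \in K, x2 \in K, y1 \in K & y2 \in K].
Proof.
move=> dK; have [|u [v [uK vK uv]]] := @hyperbolic_in K; first by lia.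
pose K1 := (K :&: orthov s <[u]> :&: orthov s <[v]>)%VS.
have K1P x : x \in K1 -> [/\ x \in K, s x u = 0 & s x v = 0].
  by rewrite !memv_cap !mem_orthov1 => /andP[/andP[-> /eqP->] /eqP->].
have [x2 [y2 [/K1P[x2K x2u x2v] /K1P[y2K y2u y2v] x2y2]]] :
    exists x2 y2, [/\ x2 \in K1, y2 \in K1 & s x2 y2 = 1].
  apply: contrapT => H; pose K2 := (K1 + <[u]>)%VS.
  have : (K2 <= orthov s K2)%VS.
    apply/orthovP => p q /memv_addP[a aK [_ /vlineP[c ->] ->]].
    case/memv_addP=> b bK [_ /vlineP[c' ->] ->].
    have [_ au _] := K1P _ aK; have [_ bu _] := K1P _ bK.
    rewrite !bilE (salt hs) au (skewC s u b) bu oppr0 !mulr0 !addr0.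
    apply: contrapT => /eqP ab; apply: H; exists a, ((s a b)^-1 *: b).
    by rewrite aK memvZ // bilZr mulVf.
  move/dimvS; have := dim_orthov K2.
  rewrite dimv_disjoint_sum; last first.
    apply/eqP; rewrite -subv0; apply/subvP => x; rewrite memv_cap memv0.
    case/andP=> /K1P[_ _ xv] /vlineP[c xE]; move: xv; rewrite xE bilE uv mulr1.
    by move=> ->; rewrite scale0r.
  have -> : \dim <[u]> = 1%N.
    rewrite dim_vline; case: eqP uv => // ->; rewrite bil0l => /esym/eqP.
    by rewrite oner_eq0.
  have := leq_dim_orthov1 s v (K :&: orthov s <[u]>).
  by have := leq_dim_orthov1 s u K; rewrite -/K1; lia.
exists u, x2, v, y2; split=> //; split; first by rewrite skewC x2u oppr0.
  by rewrite skewC y2v oppr0.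
by split=> //; rewrite skewC y2u oppr0.
Qed.

Lemma scale_notin U x a : x \notin U -> a *: x \in U -> a = 0.
Proof.
move=> xU axU; apply/eqP; apply: contraNT xU => a0.
by rewrite -[x]scale1r -(mulVf a0) -scalerA memvZ.
Qed.

Lemma scalar_mod P H (f : 'End(V)) :
  (forall x, x \in H -> x \notin P -> f x \in (<[x]> + P)%VS) ->
  (\dim P + 2 <= \dim H)%N ->
  exists c, forall x, x \in H -> f x - c *: x \in P.
Proof.
move=> fP dH.
have [x0 x0H x0P] : exists2 x, x \in H & x \notin P.
  by apply/subvPn; apply/negP => /dimvS; lia.
have [z zH zP] : exists2 z, z \in H & z \notin (<[x0]> + P)%VS.
  apply/subvPn; apply/negP => /dimvS.
  have := dimv_add_leqif <[x0]> P => /leqifP; rewrite dim_vline.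
  by case: ifP => _; [move/eqP|]; case: eqP; lia.
have PP := subvP (addvSr <[x0]> P); have X0 := subvP (addvSl <[x0]> P) _ (memv_line x0).
have /memv_addP[_ /vlineP[c ->] [p0 p0P fx0]] := fP _ x0H x0P.
have claim x : x \in H -> x \notin (<[x0]> + P)%VS -> f x - c *: x \in P.
  move=> xH xP; have xP' : x \notin P by apply: contra xP => /PP.
  have xx0P : x + x0 \notin P.
    by apply: contra xP => /PP ?; rewrite -[x](addrK x0) memvB.
  have /memv_addP[_ /vlineP[m ->] [p pP fx]] := fP _ xH xP'.
  have /memv_addP[_ /vlineP[n ->] [q qP fxx0]] := fP _ (memvD xH x0H) xx0P.
  have E : (m - n) *: x = (n - c) *: x0 + (q - p0 - p).
    move: fxx0; rewrite linearD /= fx fx0 scalerDr => E.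
    rewrite !scalerBl.
    have -> : m *: x = n *: x + n *: x0 + q - (c *: x0 + p0) - p.
      by rewrite -E !addrK.
    rewrite -(addrA (n *: x)) -(addrA (n *: x)) -(addrA (n *: x)) [n *: x + _]addrC.
    by rewrite addrK opprD addrACA -!addrA.
  have mn : m - n = 0.
    by apply: (scale_notin xP); rewrite E memvD ?memvZ // PP // !memvB.
  have nc : n - c = 0.
    apply: (scale_notin x0P); move: E; rewrite mn scale0r => /esym/eqP.
    by rewrite addr_eq0 => /eqP->; rewrite memvN !memvB.
  by rewrite fx (subr0_eq mn) (subr0_eq nc) addrAC subrr add0r.
exists c => x xH; have [xP|/(claim _ xH)//] := boolP (x \in (<[x0]> + P)%VS).
have xzP : x + z \notin (<[x0]> + P)%VS.
  by apply: contra zP => ?; rewrite -[z](addKr x) memvD ?memvN.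
have -> : f x - c *: x = f (x + z) - c *: (x + z) - (f z - c *: z).
  by rewrite linearD scalerDr /= opprD [f x + _ + _]addrACA addrK.
by apply: memvB; apply: claim => //; apply: memvD.
Qed.

End Orthogonal.

Section Dichotomy.
Variable F : fieldType.
Variables (V : vectType F) (s : {skew_symmetric V}) (hs : is_psymplectic s).

Lemma dim_line_add (u v : V) : (\dim (<[u]> + <[v]>) <= 2)%N.
Proof.
apply: leq_trans (dimv_add_leqif _ _).1 _.
by rewrite !dim_vline (leq_add (leq_b1 _) (leq_b1 _)).
Qed.

Lemma frame_eigenspace (g : 'End(V)) c :
  isometry s s g -> (8 < \dim {:V})%N ->
  (\dim {:V} <= \dim (leigenspace g c) + 3)%N ->
  exists x1 x2 y1 y2 e, [/\ frame s x1 x2 y1 y2, e * e = 1 &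
    [/\ g x1 = e *: x1, g x2 = e *: x2, g y1 = e *: y1 & g y2 = e *: y2]].
Proof.
move=> ig dV dK.
have [|x1 [x2 [y1 [y2 [fr kerP]]]]] := frame_in hs (K := leigenspace g c).
  by lia.
exists x1, x2, y1, y2, c.
have kE x : x \in leigenspace g c -> g x = c *: x.
  by rewrite /leigenspace memv_ker !lfun_simp subr_eq0 => /eqP.
case: kerP => /kE g1 /kE g2 /kE g3 /kE g4; split=> //.
have := ig x1 y1; rewrite g1 g3 !bilE mulrA.
by case: fr => _ _ [-> _ _ _]; rewrite mulr1.
Qed.

Lemma frame_pair (g : 'End(V)) x1 x2 :
  isometry s s g -> (8 < \dim {:V})%N ->
  g x1 \notin <[x1]>%VS -> s x1 x2 = 0 -> x2 \notin (<[x1]> + <[g x1]>)%VS ->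
  g x2 \notin (<[x2]> + (<[x1]> + <[g x1]>))%VS ->
  exists y1 y2, frame s x1 x2 y1 y2 /\ frame s (g x1) (g x2) y1 y2.
Proof.
move=> ig dV g1 x12 x2P g2.
set P := (<[x1]> + <[g x1]>)%VS in x2P g2.
have x1P : x1 \in P by rewrite -[x1]addr0 memv_add ?memv_line ?mem0v.
have g1P : g x1 \in P by rewrite -[g x1]add0r memv_add ?memv_line ?mem0v.
have PX : (P <= <[x2]> + P)%VS by apply: addvSr.
have x2X : x2 \in (<[x2]> + P)%VS by apply: (subvP (addvSl _ _)); apply: memv_line.
have x1S : x1 \notin (<[g x1 - x1]> + <[x2]> + <[g x2]>)%VS.
  apply/negP => /memv_addP[_ /memv_addP[_ /vlineP[a ->] [_ /vlineP[b ->] ->]]].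
  case=> _ /vlineP[c ->] E.
  have c0 : c = 0.
    apply: (scale_notin g2).
    have -> : c *: g x2 = x1 - a *: (g x1 - x1) - b *: x2.
      by rewrite {1}E -[_ - _ - _]addrA -opprD addrAC subrr add0r.
    by rewrite memvB ?memvZ // (subvP PX) // memvB ?memvZ ?memvB.
  have b0 : b = 0.
    apply: (scale_notin x2P).
    have -> : b *: x2 = x1 - a *: (g x1 - x1).
      by rewrite {1}E c0 scale0r addr0 addrAC subrr add0r.
    by rewrite memvB // memvZ // memvB.
  have a0 : a = 0.
    apply: (scale_notin g1).
    have -> : a *: g x1 = x1 + a *: x1.
      by rewrite {2}E c0 b0 !scale0r !addr0 scalerBr subrK.
    by rewrite memvD ?memvZ ?memv_line.
  case/negP: g1; move: E; rewrite a0 b0 c0 !scale0r !addr0 => ->.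
  by rewrite linear0 mem0v.
have x2S : x2 \notin (P + <[g x2 - x2]>)%VS.
  apply/negP => /memv_addP[p pP [_ /vlineP[a ->] E]].
  have a0 : a = 0.
    apply: (scale_notin g2).
    have -> : a *: g x2 = x2 - p + a *: x2.
      by rewrite {2}E scalerBr [p + _ - p]addrAC subrr add0r subrK.
    by apply: memvD; [apply: memvB => //; apply: (subvP PX)|apply: memvZ].
  by case/negP: x2P; rewrite E a0 scale0r addr0.
have [y1 y1S x1y1] := dual_vector hs x1S.
have [y2 y2S x2y2] := dual_vector hs x2S.
pose T := (P + (<[x2]> + <[g x2]>))%VS.
have dT : (\dim T <= 4)%N.
  apply: leq_trans (dimv_add_leqif _ _).1 _.
  by rewrite -[4%N]/(2 + 2)%N leq_add ?dim_line_add.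
have [|r [r' [rT rT' rr']]] := hyperbolic_in hs (K := orthov s T).
  by have := dim_orthov hs T; lia.
have TP x : x \in orthov s T ->
    [/\ s x1 x = 0, s x2 x = 0, s (g x1) x = 0 & s (g x2) x = 0].
  move=> /mem_orthovP xT; rewrite !(skewC s _ x) !xT ?oppr0 //.
  - by rewrite (subvP (addvSr _ _)) // (subvP (addvSr _ _)) // memv_line.
  - by rewrite (subvP (addvSl _ _)).
  - by rewrite (subvP (addvSr _ _)) // (subvP (addvSl _ _)) // memv_line.
  - by rewrite (subvP (addvSl _ _)).
have [r1 r2 r3 r4] := TP _ rT; have [r1' r2' r3' r4'] := TP _ rT'.
have [e1 e2 e3] : [/\ s (g x1) y1 = 1, s x2 y1 = 0 & s (g x2) y1 = 0].
  split.
  - apply/eqP; rewrite -subr_eq0 -{1}x1y1 -bilNl -bilDl y1S //.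
    by rewrite (subvP (addvSl _ _)) // (subvP (addvSl _ _)) // memv_line.
  - by apply: y1S; rewrite (subvP (addvSl _ _)) // (subvP (addvSr _ _)) // memv_line.
  - by apply: y1S; rewrite (subvP (addvSr _ _)) // memv_line.
have [e4 e5 e6] : [/\ s (g x2) y2 = 1, s x1 y2 = 0 & s (g x1) y2 = 0].
  split.
  - apply/eqP; rewrite -subr_eq0 -{1}x2y2 -bilNl -bilDl y2S //.
    by rewrite (subvP (addvSr _ _)) // memv_line.
  - by apply: y2S; rewrite (subvP (addvSl _ _)).
  - by apply: y2S; rewrite (subvP (addvSl _ _)).
have [c yr'] : exists c, s (y1 + c *: r) r' != 0.
  have [y0|y0] := eqVneq (s y1 r') 0; last by exists 0; rewrite scale0r addr0.
  by exists 1; rewrite !bilE y0 rr' add0r mulr1 oner_neq0.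
set y1' := y1 + c *: r in yr'.
exists y1', (y2 - (s y1' y2 / s y1' r') *: r').
have gx12 : s (g x1) (g x2) = 0 by rewrite ig.
have yy : s y1' (y2 - (s y1' y2 / s y1' r') *: r') = 0.
  by rewrite bilDr bilNr bilZr divfK // subrr.
split; split=> //; rewrite /y1'; split; rewrite !bilE.
all: by rewrite ?(x1y1, x2y2, e1, e2, e3, e4, e5, e6) ?(r1, r2, r3, r4)
  ?(r1', r2', r3', r4') ?mulr0 ?subr0 ?addr0.
Qed.

Lemma frame_dichotomy (g : 'End(V)) :
  isometry s s g -> (8 < \dim {:V})%N ->
  (exists x1 x2 y1 y2 e, [/\ frame s x1 x2 y1 y2, e * e = 1 &
    [/\ g x1 = e *: x1, g x2 = e *: x2, g y1 = e *: y1 & g y2 = e *: y2]]) \/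
  (exists x1 x2 y1 y2, frame s x1 x2 y1 y2 /\ frame s (g x1) (g x2) y1 y2).
Proof.
move=> ig dV.
have kerE c x : (x \in leigenspace g c) = (g x - c *: x == 0).
  by rewrite /leigenspace memv_ker !lfun_simp.
have [[x1 g1]|no_x1] := pselect (exists x1, g x1 \notin <[x1]>%VS); last first.
  left; have [x _ _||c cP] := @scalar_mod _ _ 0%VS fullv g; rewrite ?dimv0.
  - by rewrite addv0; apply/negPn/negP => gx; apply: no_x1; exists x.
  - by lia.
  apply: (frame_eigenspace (c := c)) => //.
  have /dimvS : ({:V} <= leigenspace g c)%VS.
    by apply/subvP => x xV; rewrite kerE -memv0 cP.
  by lia.
pose P := (<[x1]> + <[g x1]>)%VS.
have dP : (\dim P <= 2)%N by apply: dim_line_add.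
have dH := leq_dim_orthov1 s x1 fullv; rewrite capfv in dH.
have [[x2 [x2H x2P g2]]|no_x2] := pselect (exists x2,
  [/\ s x1 x2 = 0, x2 \notin P & g x2 \notin (<[x2]> + P)%VS]).
  by right; have [y1 [y2 H]] := frame_pair ig dV g1 x2H x2P g2; exists x1, x2, y1, y2.
left; have [x xH xP||c cP] := @scalar_mod _ _ P (orthov s <[x1]>) g.
- apply/negPn/negP => gx; apply: no_x2; exists x; split=> //.
  by move: xH; rewrite mem_orthov1 => /eqP xx1; rewrite skewC xx1 oppr0.
- by lia.
apply: (frame_eigenspace (c := c)) => //.
have := limg_ker_dim (g - c *: \1)%VF (orthov s <[x1]>).
rewrite -/(leigenspace g c).
have /dimvS : ((g - c *: \1) @: orthov s <[x1]> <= P)%VS.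
  by apply/subvP => _ /memv_imgP[x xH ->]; rewrite !lfun_simp cP.
have := dimvS (capvSr (orthov s <[x1]>) (leigenspace g c)).
lia.
Qed.

End Dichotomy.

Section Extension.
Variables (F : fieldType) (F_char : 2%N \notin [pchar F]).
Variables (V : vectType F) (s : {skew_symmetric V}) (hs : is_psymplectic s).
Variables (x1 x2 y1 y2 : V) (fr : frame s x1 x2 y1 y2).

Definition offv : {vspace V} :=
  (orthov s <[x1]> :&: orthov s <[y1]> :&: orthov s <[x2]> :&: orthov s <[y2]>)%VS.

Lemma offvP v : reflect (off s x1 x2 y1 y2 v) (v \in offv).
Proof.
rewrite !memv_cap !mem_orthov1; apply: (iffP idP).
  by case/andP=> /andP[/andP[/eqP ? /eqP ?] /eqP ?] /eqP ?.
by case=> -> -> -> ->; rewrite eqxx.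
Qed.

Lemma dim_offv : (\dim offv + 4)%N = \dim {:V}.
Proof.
have fE := frameE hs fr.
have step (U : {vspace V}) u v :
    v \in U -> s u v != 0 -> (\dim (U :&: orthov s <[u]>)).+1 = \dim U.
  move=> vU uv; rewrite -eq_dim_orthov1; last by apply/mem_orthovPn; exists v.
  rewrite prednK // lt0n dimv_eq0; apply: contraNneq uv => U0.
  by move: vU; rewrite U0 memv0 => /eqP->; rewrite bil0r.
rewrite -(step fullv x1 y1) ?memvf ?fE ?oner_neq0 // capfv.
set U1 := orthov s <[x1]>; pose U2 := (U1 :&: orthov s <[y1]>)%VS.
pose U3 := (U2 :&: orthov s <[x2]>)%VS.
have U1P v : (v \in U1) = (s v x1 == 0) by rewrite mem_orthov1.
have U2P v : (v \in U2) = (s v x1 == 0) && (s v y1 == 0).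
  by rewrite memv_cap U1P mem_orthov1.
have U3P v : (v \in U3) = [&& s v x1 == 0, s v y1 == 0 & s v x2 == 0].
  by rewrite memv_cap U2P mem_orthov1 andbA.
rewrite -(step U1 y1 x1) ?U1P ?fE ?oppr_eq0 ?oner_neq0 //.
rewrite -(step U2 x2 y2) ?U2P ?fE ?eqxx ?oner_neq0 //.
rewrite -(step U3 y2 x2) ?U3P ?fE ?oppr_eq0 ?eqxx ?oner_neq0 //.
by rewrite addn4.
Qed.

Lemma extend_reflectional k (h : 'End(V)) :
  all_reflectional F (\dim offv) k -> isometry s s h -> fixes x1 x2 y1 y2 h ->
  exists l, [/\ size l = k, {in l, forall t, Sp_involution s t},
    {in l, forall t, fixes x1 x2 y1 y2 t} & h = comps l].
Proof.
move=> all_k ih fh.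
pose T := subvs_of offv; pose inc : 'Hom(T, V) := linfun vsval.
pose prj : 'Hom(V, T) := linfun (vsproj offv).
have incE (u : T) : inc u = vsval u by rewrite lfunE.
have inc_off (u : T) : off s x1 x2 y1 y2 (inc u).
  by rewrite incE; apply/offvP/subvsP.
have incK (w : V) : off s x1 x2 y1 y2 w -> inc (prj w) = w.
  by move=> /offvP ow; rewrite incE lfunE /= vsprojK.
have prjK (u : T) : prj (inc u) = u by rewrite lfunE /= incE vsvalK.
have [sT sTE] : exists c : {skew_symmetric T}, forall u v, c u v = s (inc u) (inc v).
  by apply: pullback_skew => u v; apply: skewC.
have hT : is_psymplectic sT.
  split; [|by []|by move=> c2; case/negP: F_char].
  rewrite /nondegenerate -subv0; apply/subvP => u /mem_orthovP su.
  rewrite memv0; apply/eqP; rewrite -(prjK u).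
  suff -> : inc u = 0 by rewrite linear0.
  apply: (snondeg hs) => v; have := su (prj (fproj s x1 x2 y1 y2 v)) (memvf _).
  rewrite sTE incK; last exact: fproj_off.
  by rewrite fprojE !bilE !(offE (inc_off u)) !mulr0 oppr0 !addr0.
have h_off w := fixes_off ih fh (w := w).
have [|t [szt tP tE]] := (reflectionalP sT k (prj \o h \o inc)%VF).1 _.
  apply: all_k => //; first by rewrite dimvf.
  apply/(SpP hT) => u v; rewrite !sTE !comp_lfunE !incK ?ih //; exact: h_off.
pose lift (i : 'End(T)) := fmap s x1 x2 y1 y2 x1 x2 y1 y2 (inc \o i \o prj)%VF.
have lift_off i w : off s x1 x2 y1 y2 w -> lift i w = inc (i (prj w)).
  by move=> ow; rewrite /lift fmap_off // !comp_lfunE.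
have lift_fix i : fixes x1 x2 y1 y2 (lift i).
  by split; [apply: fmap_x1|apply: fmap_x2|apply: fmap_y1|apply: fmap_y2].
exists (map lift t); split.
- by rewrite size_map.
- move=> _ /mapP[i /tP iP ->]; split.
    apply/(SpP hs)/fmap_isometry => // [w ow|w w' ow ow']; rewrite !comp_lfunE //.
    by rewrite -sTE; case: iP => -[_ ->] _; rewrite sTE !incK.
  apply: (frame_ext hs fr) => [|w ow]; rewrite !comp_lfunE !id_lfunE.
    by have [e1 e2 e3 e4] := lift_fix i; rewrite !(e1, e2, e3, e4).
  by rewrite !lift_off // prjK (involutionE _ iP) incK.
- by move=> _ /mapP[i _ ->]; apply: lift_fix.
have liftE w : off s x1 x2 y1 y2 w -> comps (map lift t) w = inc (comps t (prj w)).
  move=> ow; elim: (t) => [|i l IHl] /=; first by rewrite !id_lfunE incK.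
  by rewrite !comp_lfunE -/(comps _) IHl lift_off // prjK.
have fixE : fixes x1 x2 y1 y2 (comps (map lift t)).
  elim: (t) => [|i l [e1 e2 e3 e4]] /=; first by split; rewrite id_lfunE.
  by case: (lift_fix i) => f1 f2 f3 f4; split; rewrite comp_lfunE ?(e1, e2, e3, e4).
apply: (frame_ext hs fr) => [|w ow].
  by case: fixE => -> -> -> ->; case: fh.
by rewrite liftE // -tE !comp_lfunE !incK //; apply: h_off.
Qed.

End Extension.

Section Step.
Variables (F : fieldType) (F_char : 2%N \notin [pchar F]).

Lemma comps_isometry_fixes (V : vectType F) (s : {skew_symmetric V}) x1 x2 y1 y2 l :
  {in l, forall t, Sp_involution s t} ->
  {in l, forall t, fixes x1 x2 y1 y2 t} ->
  isometry s s (comps l) /\ fixes x1 x2 y1 y2 (comps l).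
Proof.
elim: l => [|i l IHl] lP lfix /=.
  by split=> [u v|]; [|split]; rewrite !id_lfunE.
have [|| il [e1 e2 e3 e4]] := IHl.
- by move=> j jl; apply: lP; rewrite inE jl orbT.
- by move=> j jl; apply: lfix; rewrite inE jl orbT.
have [[_ ii] _] := lP i (mem_head _ _).
have [f1 f2 f3 f4] := lfix i (mem_head _ _).
split=> [u v|]; first by rewrite !comp_lfunE ii il.
by split; rewrite comp_lfunE -/(comps l) ?(e1, e2, e3, e4).
Qed.

Lemma lft_dil_reflectional (V : vectType F) (s : {skew_symmetric V})
    (hs : is_psymplectic s) x1 x2 y1 y2 z1 z2 d l :
  frame s x1 x2 y1 y2 -> frame s z1 z2 y1 y2 -> (1 < size l)%N ->
  {in l, forall t, Sp_involution s t} ->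
  {in l, forall t, fixes x1 x2 y1 y2 t} ->
  d != 0 -> d * d != 1 -> (forall w, comps l w = d *: w -> w = 0) ->
  reflectional s (size l)
    (lft s x1 x2 y1 y2 z1 z2 \o (dil s x1 x2 y1 y2 d \o comps l))%VF.
Proof.
move=> fr fz szl lP lfix d0 d1 eig.
have [il fl] := comps_isometry_fixes lP lfix.
have [Q [Q' [QK Q'K iQ ->]]] := lft_dil_conj hs fr fz il fl d0 d1 eig.
apply: (reflectional_conj QK Q'K iQ).
exact: dil_comp_reflectional.
Qed.

(* Both factors of [g = (L D A) (D^-1 B R^-1)] are handled by
   [lft_dil_reflectional]: the inverse of the second one is [R D B^-1], which has
   the shape of the first one for the frame [(y1, y2, - x1, - x2)], with [d^-1] in
   place of [d]. *)
Lemma frame_shift_reflectional (F_infinite : infinite_set [set: F]%classic)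
    (V : vectType F) (s : {skew_symmetric V}) (hs : is_psymplectic s)
    k (g : 'End(V)) x1 x2 y1 y2 :
  (3 < k)%N -> isometry s s g -> frame s x1 x2 y1 y2 ->
  frame s (g x1) (g x2) y1 y2 ->
  all_reflectional F (\dim (offv s x1 x2 y1 y2)) k -> reflectional s k g.
Proof.
move=> k3 ig fr fg all_k.
have kg : lker g == 0%VS by rewrite (isometry_inj hs ig).
pose g' := (g^-1)%VF.
have gK v : g (g' v) = v by rewrite lker0_lfunVK.
have fr' := frame_swap hs fr.
have fg' : frame s (g' y1) (g' y2) (- x1) (- x2).
  have E := frameE hs fg; split; first by rewrite -ig !gK (frameE hs fr).
    by rewrite !bilE (frameE hs fr) !oppr0.
  by split; rewrite -ig linearN /= gK bilNr E ?opprK ?oppr0.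
pose L := lft s x1 x2 y1 y2 (g x1) (g x2).
pose R := lft s y1 y2 (- x1) (- x2) (g' y1) (g' y2).
have iL : isometry s s L by apply: lft_isometry.
have iR : isometry s s R by apply: lft_isometry.
have kL : lker L == 0%VS by rewrite (isometry_inj hs iL).
have LK v : L (L^-1%VF v) = v by rewrite lker0_lfunVK.
pose h := (L^-1 \o (g \o R))%VF.
have ih : isometry s s h by move=> u v; rewrite -iL !comp_lfunE !LK ig iR.
have Lx1 : L x1 = g x1 by apply: lft_x1.
have Lx2 : L x2 = g x2 by apply: lft_x2.
have Ly1 : L y1 = y1 by apply: lft_y1.
have Ly2 : L y2 = y2 by apply: lft_y2.
have Ry1 : R y1 = g' y1 by apply: lft_x1.
have Ry2 : R y2 = g' y2 by apply: lft_x2.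
have Rx1 : R x1 = x1.
  by apply: oppr_inj; rewrite -linearN; apply: lft_y1.
have Rx2 : R x2 = x2.
  by apply: oppr_inj; rewrite -linearN; apply: lft_y2.
have /lker0P injL := kL.
have fh : fixes x1 x2 y1 y2 h.
  split; apply: injL; rewrite !comp_lfunE LK.
  - by rewrite Rx1.
  - by rewrite Rx2.
  - by rewrite Ry1 gK.
  - by rewrite Ry2 gK.
have [l [szl lP lfix hE]] := extend_reflectional F_char hs fr all_k ih fh.
pose l1 := take 2 l; pose l2 := drop 2 l.
have l1P i : i \in l1 -> i \in l by apply: mem_take.
have l2P i : i \in l2 -> i \in l by apply: mem_drop.
have sz1 : size l1 = 2%N by rewrite size_takel // szl; lia.
have sz2 : size (rev l2) = (k - 2)%N by rewrite size_rev size_drop szl.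
have BB' : (comps l2 \o comps (rev l2) = \1)%VF.
  by apply: (comps_rev (s := s)) => i /l2P/lP.
have [d [d0 d1 eigA eigB]] := generic_scalar F_infinite (comps l1) (comps l2).
have P1 := lft_dil_reflectional hs fr fg _ _ _ d0 d1 eigA.
have {P1} : reflectional s 2 (L \o (dil s x1 x2 y1 y2 d \o comps l1))%VF.
  rewrite -sz1; apply: P1; rewrite ?sz1 // => i /l1P; [exact: lP|exact: lfix].
set D := dil s x1 x2 y1 y2 d => P1.
have DE : dil s y1 y2 (- x1) (- x2) d^-1 = D by apply: dil_swap.
have P2 : reflectional s (k - 2) (R \o (D \o comps (rev l2)))%VF.
  rewrite -sz2 -DE; apply: lft_dil_reflectional => //.
  - by rewrite sz2; lia.
  - by move=> i; rewrite mem_rev => /l2P/lP.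
  - move=> i; rewrite mem_rev => /l2P/lfix[e1 e2 e3 e4].
    by split; rewrite ?linearN /= ?e1 ?e2.
  - by rewrite invr_eq0.
  - by rewrite -invfM invr_eq1.
  - move=> w Bw; apply: eigB.
    have := congr1 (comps l2) Bw; rewrite linearZ /= -comp_lfunE BB' id_lfunE.
    by move=> {2}->; rewrite scalerA divff // scale1r.
set N := (R \o (D \o comps (rev l2)))%VF in P2.
have kN : lker N == 0%VS.
  have [|| iB _] := @comps_isometry_fixes _ s x1 x2 y1 y2 (rev l2).
  - by move=> i; rewrite mem_rev => /l2P/lP.
  - by move=> i; rewrite mem_rev => /l2P/lfix.
  rewrite (isometry_inj hs) // => u v.
  by rewrite !comp_lfunE iR dil_isometry // iB.
have gN : (g \o N = L \o (D \o comps l1))%VF.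
  have Dh : (h \o D = D \o h)%VF.
    apply: (fmap_comm hs fr ih fh); case: fh => e1 e2 e3 e4.
    by split; rewrite linearZ /= ?(e1, e2, e3, e4).
  have gR : (g \o R = L \o h)%VF.
    by rewrite /h comp_lfunA lker0_compfV // comp_lfun1l.
  rewrite /N !comp_lfunA gR -(comp_lfunA L) Dh hE.
  by rewrite -(cat_take_drop 2 l) comps_cat -/l1 -/l2 -!comp_lfunA BB' comp_lfun1r.
have -> : g = ((L \o (D \o comps l1)) \o N^-1)%VF.
  by rewrite -gN -comp_lfunA lker0_compfV // comp_lfun1r.
rewrite -(subnKC (_ : 2 <= k)%N); last by lia.
apply: reflectional_comp => //; apply: (reflectional_inv _ P2).
exact: lker0_compfV.
Qed.

Lemma all_reflectional_step (F_infinite : infinite_set [set: F]%classic) n k :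
  (4 < n)%N -> all_reflectional F n k -> all_reflectional F (n + 4) k.
Proof.
move=> n4 all_k V s dV hs g [_ ig].
have dimW x1 x2 y1 y2 : frame s x1 x2 y1 y2 -> \dim (offv s x1 x2 y1 y2) = n.
  by move=> fr; apply/eqP; rewrite -(eqn_add2r 4) (dim_offv hs fr) dV.
have extend x1 x2 y1 y2 (h : 'End(V)) (fr : frame s x1 x2 y1 y2) :
    isometry s s h -> fixes x1 x2 y1 y2 h ->
    exists l, [/\ size l = k, {in l, forall t, Sp_involution s t} & h = comps l].
  move=> ih fh.
  have [|l [szl lP _ hE]] := extend_reflectional F_char hs fr _ ih fh (k := k).
    by rewrite dimW.
  by exists l.
have k3 : (3 < k)%N.
  have [|x1 [x2 [y1 [y2 [fr _]]]]] := frame_in hs (K := fullv); first by lia.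
  pose W := offv s x1 x2 y1 y2; pose u := vpick W.
  have u0 : u != 0 by rewrite vpick0 -dimv_eq0 dimW //; lia.
  have /(offvP _) ou : u \in W by apply: memv_pick.
  pose f := (\1 + rank1 s u u)%VF.
  have fE x : f x = x + s x u *: u by rewrite !lfun_simp rank1E.
  have iff : isometry s s f.
    by move=> a b; rewrite !fE !bilE (salt hs) (skewC s u b); ring.
  have [|l [szl lP fl]] := extend _ _ _ _ f fr iff.
    by split; rewrite fE !(offE ou) scale0r addr0.
  rewrite ltnNge; apply/negP => k3.
  apply: (transvection_not_reflectional3 F_char hs u0 fE).
  by apply: (reflectional_leq k3); apply/reflectionalP; exists l.
have [|H|[x1 [x2 [y1 [y2 [fr fg]]]]]] := frame_dichotomy hs ig; first by lia.
  have [x1 [x2 [y1 [y2 [e [fr ee [g1 g2 g3 g4]]]]]]] := H.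
  have [|| l [szl lP gl]] := extend _ _ _ _ (e *: g) fr.
  - by move=> u v; rewrite !scale_lfunE !bilE mulrA ee mul1r ig.
  - by split; rewrite scale_lfunE ?(g1, g2, g3, g4) scalerA ee scale1r.
  have gE : g = e *: (e *: g) by rewrite scalerA ee scale1r.
  case: l szl lP gl => [|t l] szl lP gl; first by rewrite -szl in k3.
  apply/reflectionalP; exists ((e *: t) :: l).
  split; [exact: szl| |by rewrite gE gl /= comp_lfunZl].
  move=> i; rewrite inE => /orP[/eqP->|il]; last by apply: lP; rewrite inE il orbT.
  have [[_ it] tt] := lP t (mem_head _ _); split.
    by apply/(SpP hs) => u v; rewrite !scale_lfunE !bilE mulrA ee mul1r it.
  by rewrite -comp_lfunZl -comp_lfunZr scalerA ee scale1r.
by apply: (frame_shift_reflectional F_infinite hs k3 ig fr fg); rewrite dimW.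
Qed.

End Step.

Lemma leastoo_le (P Q : nat -> Prop) :
  (forall k, P k -> Q k) -> leoo (leastoo Q) (leastoo P).
Proof.
move=> PQ; rewrite /leastoo.
case: pselect => [exQ|nQ]; case: pselect => [exP|nP] //=; last first.
  by case: exP => k /asboolP/PQ Qk; case: nQ; exists k; apply/asboolP.
case: ex_minnP => m _ minQ; case: ex_minnP => n /asboolP/PQ Qn _.
by apply: minQ; apply/asboolP.
Qed.

Local Close Scope ring_scope.

Theorem theorem1p2 (F : fieldType)
    (F_infinite : infinite_set [set: F]%classic)
    (F_char : 2 \notin [pchar F]%R) :
  forall i j : nat, (1 <= i)%N -> (i <= j)%N ->
    leoo (ell F (4 * j + 2)%N) (ell F (4 * i + 2)%N).
Proof.
move=> i j i1 /subnKC <-; apply: leastoo_le => k; move: (j - i)%N => m all_i.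
elim: m => [|m IHm]; first by rewrite addn0.
have -> : (4 * (i + m.+1) + 2 = 4 * (i + m) + 2 + 4)%N by lia.
apply: all_reflectional_step => //; lia.
Qed.
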